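(* Let $A$ be a commutative unital real algebra and let $A_1,\dots,A_m$, $m\in\mathbb{N}$, be subalgebras of $A$, each containing the unit element of $A$, such that the algebra $A$ is generated by $A_1,\dots,A_m$. For each $i=1,\dots,m$ let $C_i$ be an Archimedean semiring or an Archimedean quadratic module of the algebra $A_i$. Let $M$ be a unital cone of $A$. Then for any element $a\in A$ the following are equivalent: (i) $\chi(a)>0$ for all characters $\chi$ of $A$ with $\chi\in \mathrm{char}(A;M)$ and $\chi\in\mathrm{char}(A;C_i)$ for every $i=1,\dots,m$, that is, for all $\chi\in \mathrm{char}(A;M)\cap\bigcap_{i=1}^m \mathrm{char}(A;C_i)$. (ii) There exists a number $\varepsilon>0$ such that $a\in\varepsilon+\mathrm{cone}(M,C_1,\dots,C_m)$.
   Context: For $\alpha\in\mathbb{R}$ we write $\alpha$ for $\alpha\cdot 1$ in an algebra. Let $B$ be a commutative unital real algebra. A cone in $B$ is a subset $C\subseteq B$ with $\lambda c\in C$ and $c+d\in C$ for all $c,d\in C$ and real $\lambda\ge 0$; it is unital if $1\in C$. A unital cone $C$ of $B$ is: - a quadratic module of $B$ if $a^2b\in C$ for all $b\in C$, $a\in B$; - a semiring of $B$ if $C\cdot C\subseteq C$; - Archimedean (in $B$) if for each $a\in B$ there is $\lambda>0$ with $\lambda-a\in C$ and $\lambda+a\in C$. If $C_1,\dots,C_n$ are unital cones of subalgebras of $A$ (each containing $1$; a subalgebra may be $A$ itself), then $\mathrm{cone}(C_1,\dots,C_n)$ is the set of all finite sums $\sum_{k=1}^r c_{1k}\cdots c_{nk}$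 with $r\in\mathbb{N}$ and $c_{jk}\in C_j$. A character of $A$ is a unital algebra homomorphism $A\to\mathbb{R}$. For a subset $C\subseteq A$, $\mathrm{char}(A;C)$ is the set of characters $\chi$ of $A$ with $\chi(c)\ge 0$ for all $c\in C$. *)

(* Defs.v *)
From HB Require Import structures.
From mathcomp Require Import all_boot all_order all_algebra.
From mathcomp Require Import boolp classical_sets reals.

Set Implicit Arguments.
Unset Strict Implicit.
Unset Printing Implicit Defensive.

Import Order.TTheory GRing.Theory Num.Theory.

Local Open Scope classical_set_scope.
Local Open Scope ring_scope.

Section Cones.
Variables (R : realType) (A : comAlgType R).

(* Subalgebras contain the unit of A: this is part of GRing.subalg_closed. *)
Definition subalgebra (B : set A) : Prop := GRing.subalg_closed (mem B).

Definition generated_by (I : Type) (B : I -> set A) : Prop :=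
  smallest subalgebra (\bigcup_i B i) = setT.

(* Cones of a subalgebra B are represented as subsets of A contained in B;
   taking B := setT gives the cones of A itself. *)
Definition is_cone (B C : set A) : Prop :=
  [/\ C `<=` B,
      forall (l : R) (c : A), 0 <= l -> C c -> C (l *: c)
    & forall c d : A, C c -> C d -> C (c + d)].

Definition unital_cone (B C : set A) : Prop := is_cone B C /\ C 1.

Definition quadratic_module (B C : set A) : Prop :=
  unital_cone B C /\ forall a b : A, B a -> C b -> C (a ^+ 2 * b).

Definition is_semiring (B C : set A) : Prop :=
  unital_cone B C /\ forall c d : A, C c -> C d -> C (c * d).

Definition archimedean (B C : set A) : Prop :=
  forall a : A, B a ->
    exists l : R, [/\ 0 < l, C (l%:A - a) & C (l%:A + a)].

Definition cone (n : nat) (C : 'I_n -> set A) : set A :=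
  [set x | exists (r : nat) (c : 'I_n -> 'I_r -> A),
     (forall j k, C j (c j k)) /\ x = \sum_(k < r) \prod_(j < n) c j k].

(* The family M, C_0, ..., C_(m-1), with M at index 0. *)
Definition cons_family (m : nat) (M : set A) (C : 'I_m -> set A) :
    'I_m.+1 -> set A :=
  fun i => oapp C M (unlift ord0 i).

(* Over the scaling law *%R, an lrmorphism into R satisfies
   chi (l *: x) = l * chi x, so R itself can serve as the codomain. *)
Definition character : Type := {lrmorphism A -> R | *%R}.

Definition char (C : set A) : set character :=
  [set chi : character | forall c : A, C c -> 0 <= chi c].

End Cones.

(* Main.v *)
Require Import Defs.
From HB Require Import structures.
From mathcomp Require Import all_boot all_order all_algebra.
From mathcomp Require Import boolp classical_sets reals.
From mathcomp Require Import ring lra.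

Set Implicit Arguments.
Unset Strict Implicit.
Unset Printing Implicit Defensive.

Import Order.TTheory GRing.Theory Num.Theory.

Local Open Scope classical_set_scope.
Local Open Scope ring_scope.

(** Write [K] for [cone (cons_family M C)].  If [a - eps] lies outside [K] for
    every [eps > 0], a character that is nonnegative on [M] and on all [C i] and
    nonpositive at [a] has to be produced; the converse implication only uses
    that such characters are multiplicative, hence nonnegative on [K].

    Since [A] is spanned by products [d_1 ... d_m] with [d_j] in [B j], and
    bounds [l_j +- d_j] in [C j] multiply to bounds of the product
    ([prod_dominated]), the cone [K] is Archimedean: [1] is an order unit.  Hence
    some extreme point of the convex set of states of [K] is nonpositive at [a]
    ([exists_pure_state]), where a state is a linear form that is nonnegative on
    [K] and maps [1] to [1].

    A pure state [phi] is a character ([pure_state_mul]).  If multiplication by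
    [p] preserves [K] and [phi (p x) <= r phi x] on [K] for some [r], then
    [x |-> phi (p x)] is dominated by a multiple of [phi], so it is proportional
    to [phi], that is, [phi (p x) = phi p * phi x].  Such [p] span each [B i]:
    if [C i] is a semiring, every element of [C i] is of this kind; if [C i] is a
    quadratic module, every square of [B i] is.  In the second case [r - p]
    need not multiply [C i] into itself, and the domination is an analytic fact
    ([square_contraction]): if [1 - b^2] is in [C i], the numbers
    [phi (b^(2k) x)] are bounded in [k] ([powers_bounded]), while positivity on
    squares would make them grow geometrically if [phi (b^2 x) > 2 phi x]
    ([bounded_growth]). *)

(** * Subalgebras *)

Section Subalgebras.
Variables (R : realType) (A : comAlgType R).
Implicit Types (B : set A).

Lemma subalgP (S : set A) : subalgebra S <->
  [/\ S 1, forall (l : R) x y, S x -> S y -> S (l *: x + y)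
    & forall x y, S x -> S y -> S (x * y)].
Proof.
split=> [[S1 SL SM]|[S1 SL SM]]; split.
- exact: set_mem.
- by move=> l x y /mem_set Sx /mem_set Sy; apply: set_mem; apply: SL.
- by move=> x y /mem_set Sx /mem_set Sy; apply: set_mem; apply: SM.
- exact: mem_set.
- by move=> l x y /set_mem Sx /set_mem Sy; apply: mem_set; apply: SL.
- by move=> x y /set_mem Sx /set_mem Sy; apply: mem_set; apply: SM.
Qed.

Lemma subalgebra_scale_shift B : subalgebra B ->
  (forall (l : R) x, B x -> B (l *: x)) /\
  (forall (l : R) x, B x -> B (x + l%:A)).
Proof.
move=> /subalgP[B1 BL _].
have B0 : B 0 by have := BL (-1) _ _ B1 B1; rewrite scaleN1r addNr.
split=> l x Bx; first by have := BL l _ _ Bx B0; rewrite addr0.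
by rewrite addrC; apply: BL.
Qed.

(** A subalgebra is spanned by the squares of its elements, because
    [4 b = (b + 1)^2 - (b - 1)^2]. *)
Lemma square_span_ind B (P : set A) : subalgebra B ->
  (forall (l : R) x y, P x -> P y -> P (l *: x + y)) ->
  (forall d, B d -> P (d ^+ 2)) -> B `<=` P.
Proof.
move=> subB PL Psq b Bb; have [BZ Bc] := subalgebra_scale_shift subB.
have P0 : P 0 by have := Psq _ (BZ 0 _ Bb); rewrite scale0r expr0n.
have -> : b = 4^-1 *: (b + 1%:A) ^+ 2 + ((- 4^-1) *: (b + (-1)%:A) ^+ 2 + 0).
  rewrite addr0 scaleNr -scalerBr scale1r scaleN1r.
  have -> : (b + 1) ^+ 2 - (b - 1) ^+ 2 = 4 * b by ring.
  by rewrite mulr_natl -scaler_nat scalerA mulVf ?pnatr_eq0 // scale1r.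
apply: (PL); first exact/Psq/Bc.
by apply: (PL) => //; exact/Psq/Bc.
Qed.

End Subalgebras.

(** * The product cone *)

Lemma prod_update (A : comPzSemiRingType) m (f : 'I_m -> A) p i :
  \prod_j (if j == i then p * f j else f j) = p * \prod_j f j.
Proof.
rewrite (bigD1 i) //= eqxx [in RHS](bigD1 i) //= mulrA; congr (_ * _).
by apply: eq_bigr => j /negPf ->.
Qed.

Lemma cone_add (R : realType) (A : comAlgType R) n (F : 'I_n -> set A) x y :
  cone F x -> cone F y -> cone F (x + y).
Proof.
move=> [r [c [Fc ->]]] [s [d [Fd ->]]].
exists (r + s)%N, (fun j k =>
  match split k with inl k1 => c j k1 | inr k2 => d j k2 end).
split; first by move=> j k; case: split.
rewrite big_split_ord; congr (_ + _); apply: eq_bigr => k _; apply: eq_bigr => j _.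
  case: splitP => [k1 /= /ord_inj -> //|k2 /= E].
  by have := ltn_ord k; rewrite E ltnNge leq_addr.
case: splitP => [k1 /= E|k2 /= /addnI /ord_inj -> //].
by have := ltn_ord k1; rewrite -E ltnNge leq_addr.
Qed.

Section ProductCone.
Variables (R : realType) (A : comAlgType R) (m : nat).
Variables (C : 'I_m -> set A) (M : set A).
Let K := cone (cons_family M C).

Lemma mem_cone_prod c0 f : M c0 -> (forall j, C j (f j)) ->
  K (c0 * \prod_(j < m) f j).
Proof.
move=> Mc0 Cf; exists 1%N, (fun i _ => oapp f c0 (unlift ord0 i)); split.
  by move=> i _; rewrite /cons_family; case: unlift.
rewrite big_ord1 big_ord_recl unlift_none; congr (_ * _).
by apply: eq_bigr => j _; rewrite liftK.
Qed.

Lemma cone_ind (P : set A) : P 0 -> (forall x y, P x -> P y -> P (x + y)) ->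
  (forall c0 f, M c0 -> (forall j, C j (f j)) -> P (c0 * \prod_(j < m) f j)) ->
  K `<=` P.
Proof.
move=> P0 PD Pprod _ [r [c [Fc ->]]]; apply: (big_ind P) => // k _.
rewrite big_ord_recl; apply: Pprod => [|j].
  by have := Fc ord0 k; rewrite /cons_family unlift_none.
by have := Fc (lift ord0 j) k; rewrite /cons_family liftK.
Qed.

(** This is why [K], which is neither a semiring nor a quadratic module in
    general, still admits many multipliers: a factor [p] that acts on [C i] can
    be absorbed into the [i]-th slot of every product. *)
Lemma cone_mull p i : (forall c, C i c -> C i (p * c)) ->
  forall x, K x -> K (p * x).
Proof.
move=> Cp; apply: cone_ind => [|x y Kx Ky|c0 f Mc0 Cf].
- by rewrite mulr0; exists 0%N, (fun _ _ => 0); split=> [? []|]; rewrite ?big_ord0.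
- by rewrite mulrDr; apply: cone_add.
rewrite mulrCA -(prod_update f p i); apply: mem_cone_prod => // j.
by case: eqP => [->|_]; [apply: Cp|].
Qed.

Hypothesis hM : unital_cone setT M.
Hypothesis C1 : forall i, C i 1.

Lemma unital_product_cone : unital_cone setT K.
Proof.
have [[_ MZ _] M1] := hM; split; last first.
  by have := mem_cone_prod M1 C1; rewrite big1 // mulr1.
split=> // [l c l0|]; last exact: cone_add.
move: c; apply: cone_ind => [|x y Kx Ky|c0 f Mc0 Cf].
- by rewrite scaler0; exists 0%N, (fun _ _ => 0); split=> [? []|]; rewrite ?big_ord0.
- by rewrite scalerDr; apply: cone_add.
by rewrite scalerAl; apply: mem_cone_prod => //; apply: MZ.
Qed.

Lemma sub_product_coneM : M `<=` K.
Proof. by move=> c Mc; have := mem_cone_prod Mc C1; rewrite big1 // mulr1. Qed.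

Lemma sub_product_cone i : C i `<=` K.
Proof.
move=> c Cc; have M1 := hM.2.
have := @mem_cone_prod 1 (fun j => if j == i then c * 1 else 1) M1.
rewrite (prod_update (fun=> 1)) big1 // mul1r mulr1; apply=> j.
by case: eqP => [->|].
Qed.

(** With [u_j] for the bound of [e_j], this is the many-factor form of
    [2 (u1 u2 - e1 e2) = (u1 - e1)(u2 + e2) + (u1 + e1)(u2 - e2)].  The factors
    on the right lie in cones [C j] with different indices, so the identity does
    not leave [K] although a single [C j] may not be closed under products. *)
Lemma prod_dominated (u e : 'I_m -> A) :
  (forall j, C j (u j - e j) /\ C j (u j + e j)) ->
  K (\prod_j u j - \prod_j e j) /\ K (\prod_j u j + \prod_j e j).
Proof.
move=> ue; have [[_ KZ KD] K1] := unital_product_cone.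
(* The slots in [s] hold the entries of [u] or [e], and the other slots hold
   arbitrary elements of the cones.  The latter must be quantified in the
   induction: the slot added to [s] is filled with [u i - e i] or [u i + e i]
   when the induction hypothesis is used. *)
pose mix (s : seq 'I_m) (v f : 'I_m -> A) :=
  \prod_j (if j \in s then v j else f j).
suff H s : uniq s -> forall f, (forall j, C j (f j)) ->
    K (mix s u f - mix s e f) /\ K (mix s u f + mix s e f).
  have := H _ (enum_uniq 'I_m) _ C1.
  have mixE v f : mix (enum 'I_m) v f = \prod_j v j.
    by apply: eq_bigr => j _; rewrite mem_enum.
  by rewrite !mixE.
elim: s => [_ f Cf|i s IHs /= /andP[si us] f Cf].
  have -> v : mix [::] v f = \prod_j f j by [].
  have Kf : K (\prod_j f j).
    by rewrite -[X in K X]mul1r; apply: mem_cone_prod hM.2 Cf.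
  by split; [rewrite subrr -(scale0r 1); apply: KZ|apply: KD].
pose rest v := \prod_(j | j != i) (if j \in s then v j else f j).
have mix_cons v : mix (i :: s) v f = v i * rest v.
  rewrite /mix (bigD1 i) //= in_cons eqxx; congr (_ * _).
  by apply: eq_bigr => j /negPf ji; rewrite in_cons ji.
have IHi p : C i p -> K (p * (rest u - rest e)) /\ K (p * (rest u + rest e)).
  move=> Cp; pose g j := if j == i then p else f j.
  have mix_g v : mix s v g = p * rest v.
    rewrite /mix (bigD1 i) //= (negPf si) /g eqxx; congr (_ * _).
    by apply: eq_bigr => j /negPf ji; rewrite ji.
  have := IHs us g; rewrite !mix_g mulrBr mulrDr; apply=> j.
  by rewrite /g; case: eqP => [->|].
have [/IHi[Kmm Kmp] /IHi[Kpm Kpp]] := ue i.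
have half x : K (x + x) -> K x.
  move=> Kx; have -> : x = 2^-1 *: (x + x).
    by rewrite -mulr2n -scaler_nat scalerA mulVf ?scale1r ?pnatr_eq0.
  by apply: KZ => //; rewrite invr_ge0.
rewrite !mix_cons; split; apply: half.
  have -> : u i * rest u - e i * rest e + (u i * rest u - e i * rest e) =
    (u i - e i) * (rest u + rest e) + (u i + e i) * (rest u - rest e) by ring.
  exact: KD.
have -> : u i * rest u + e i * rest e + (u i * rest u + e i * rest e) =
  (u i - e i) * (rest u - rest e) + (u i + e i) * (rest u + rest e) by ring.
exact: KD.
Qed.

End ProductCone.

Section Generated.
Variables (R : realType) (A : comAlgType R) (m : nat) (B : 'I_m -> set A).
Hypothesis subB : forall i, subalgebra (B i).
Hypothesis genB : generated_by B.

Lemma generated_sub (S : set A) :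
  subalgebra S -> (forall i, B i `<=` S) -> forall x, S x.
Proof.
move=> Ssub BS x; have : [set: A] x by [].
rewrite -genB; apply: smallest_sub => // y [i _]; exact: BS.
Qed.

(** [A] is the linear span of the products with one factor in each [B j]:
    commutativity makes this span stable under multiplication by each [B i],
    and the elements that multiply it into itself form a subalgebra. *)
Lemma product_span_ind (P : set A) :
  (forall (l : R) x y, P x -> P y -> P (l *: x + y)) ->
  (forall d, (forall j, B j (d j)) -> P (\prod_j d j)) ->
  forall x, P x.
Proof.
move=> PL Pprod.
(* The span is the intersection of the submodules containing the products. *)
pose submod (Q : set A) :=
  (forall (l : R) x y, Q x -> Q y -> Q (l *: x + y)) /\
  (forall d, (forall j, B j (d j)) -> Q (\prod_j d j)).
pose span (x : A) := forall Q, submod Q -> Q x.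
have spanL (l : R) x y : span x -> span y -> span (l *: x + y).
  by move=> sx sy Q sQ; apply: sQ.1; [apply: sx|apply: sy].
have span_prod d : (forall j, B j (d j)) -> span (\prod_j d j).
  by move=> Bd Q [_]; apply.
have B1 j : B j 1 by have /subalgP[] := subB j.
have span1 : span 1 by have := span_prod _ B1; rewrite big1.
suff H x : forall y, span y -> span (x * y).
  by move=> x; rewrite -[x]mulr1; apply: (H x 1 span1).
move: x; apply: generated_sub => [|i b Bb y].
  apply/subalgP; split=> [|l x z Hx Hz y sy|x z Hx Hz y sy].
  - by move=> y; rewrite mul1r.
  - by rewrite mulrDl -scalerAl; apply: spanL; [apply: Hx|apply: Hz].
  - by rewrite -mulrA; apply: Hx; apply: Hz.
move=> sy; apply: (sy (fun z => span (b * z))).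
split=> [l x z|d Bd]; first by rewrite mulrDr -scalerAr; apply: spanL.
rewrite -(prod_update d b i); apply: span_prod => j.
by case: eqP => [->|//]; have /subalgP[_ _ BM] := subB i; apply: BM.
Qed.

End Generated.

(** * Pure states of an Archimedean cone *)

Section PureStates.
Variables (R : realType) (A : comAlgType R).
Implicit Types (K N : set A) (psi : {scalar A}).

Lemma cone_alg N (l : R) : unital_cone setT N -> 0 <= l -> N l%:A.
Proof. by move=> [[_ NZ _] N1] l0; apply: NZ. Qed.

Lemma cone_nonneg_const N (l : R) :
  unital_cone setT N -> ~ N (-1) -> N l%:A -> 0 <= l.
Proof.
move=> [[_ NZ _] N1] Nm1 Nl; rewrite leNgt; apply/negP => l0; apply: Nm1.
have -> : -1 = (- l^-1) *: (l%:A : A).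
  by rewrite scalerA mulNr mulVf ?lt_eqF// scaleN1r.
by apply: NZ => //; rewrite oppr_ge0 invr_le0 ltW.
Qed.

Lemma scalar_const psi (l : R) : psi l%:A = l * psi 1.
Proof. exact: linearZ. Qed.

(** For a cone [N] that is Archimedean and omits [-1], [t] is the supremum of
    the [r] with [b - r] in [N], and the minimum of [b] over the states of
    [N]. *)
Definition threshold N (b : A) (t : R) :=
  (forall e : R, 0 < e -> N (b - t%:A + e%:A)) /\
  (forall e : R, 0 < e -> ~ N (b - t%:A - e%:A)).

Lemma threshold_exists N b :
  unital_cone setT N -> archimedean setT N -> ~ N (-1) ->
  exists t, threshold N b t.
Proof.
move=> uN arN Nm1; have [[_ NZ ND] N1] := uN.
have [l [l0 Nlm Nlp]] := arN b I.
pose E := [set r : R | N (b - r%:A)].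
have supE : has_sup E.
  split.
    by exists (- l); rewrite /E /= scaleNr opprK addrC.
  exists l => r Er; rewrite -subr_ge0; apply: (cone_nonneg_const uN Nm1).
  have -> : (l - r)%:A = (l%:A - b) + (b - r%:A) :> A.
    by rewrite -!in_algE; ring.
  exact: ND.
exists (sup E); split=> e e0.
  have [r Er lr] := sup_adherent e0 supE.
  have -> : b - (sup E)%:A + e%:A = (b - r%:A) + (r - (sup E - e))%:A.
    by rewrite -!in_algE; ring.
  by apply: ND => //; apply: cone_alg => //; rewrite subr_ge0 ltW.
move=> Ne; have : E (sup E + e).
  rewrite /E /=; have -> // : b - (sup E + e)%:A = b - (sup E)%:A - e%:A.
  by rewrite -!in_algE; ring.
by move/(sup_upper_bound supE); rewrite gerDl leNgt e0.
Qed.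

Lemma ge0_of_perturbed_ge0 (y p : R) :
  0 <= p -> (forall e, 0 < e -> 0 <= y + e * p) -> 0 <= y.
Proof.
move=> p0 H; rewrite leNgt; apply/negP => y0.
have p1 : 0 < 2 * (p + 1) by lra.
have e0 : 0 < - y / (2 * (p + 1)) by apply: divr_gt0 => //; lra.
have := H _ e0; set e := _ / _ in e0 *.
have eE : e * (2 * (p + 1)) = - y by rewrite /e divfK// gt_eqF.
by lra.
Qed.

Lemma threshold_le N b t psi : N 1 -> threshold N b t ->
  (forall x, N x -> 0 <= psi x) -> t * psi 1 <= psi b.
Proof.
move=> N1 [Nb _] psiN; rewrite -subr_ge0; apply: (@ge0_of_perturbed_ge0 _ (psi 1)).
  exact: psiN.
move=> e e0; have := psiN _ (Nb _ e0).
by rewrite linearD linearB !scalar_const.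
Qed.

(** The linear forms that are nonnegative on [N] make up a face of the cone of
    linear forms that are nonnegative on [K]; by symmetry the conclusion holds
    for [psi2] too.  Enlarging [N] shrinks the face, so pure states are reached
    from maximal cones [N] of this kind. *)
Definition face_cone K N : Prop :=
  [/\ is_cone setT N, K `<=` N, ~ N (-1)
    & forall psi1 psi2 : {scalar A},
        (forall x, K x -> 0 <= psi1 x) -> (forall x, K x -> 0 <= psi2 x) ->
        (forall x, N x -> 0 <= psi1 x + psi2 x) ->
        forall x, N x -> 0 <= psi1 x].

Definition adjoin_ray N (y : A) : set A :=
  [set x | exists n s, [/\ N n, 0 <= s & x = n + s *: y]].

Lemma sub_adjoin_ray N y : N `<=` adjoin_ray N y.
Proof. by move=> x Nx; exists x, 0; split; rewrite // scale0r addr0. Qed.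

Lemma mem_adjoin_ray N y : N 0 -> adjoin_ray N y y.
Proof. by move=> N0; exists 0, 1; split; rewrite // scale1r add0r. Qed.

Lemma cone0 N : is_cone setT N -> N 1 -> N 0.
Proof. by move=> [_ NZ _] N1; rewrite -(scale0r 1); apply: NZ. Qed.

(** Dually, this passes to the face on which [b] takes its minimum [t] over the
    states of [N]: both [psi1 b] and [psi2 b] are at least [t] times the value
    at [1], so a sum that attains the bound forces equality for each. *)
Lemma face_cone_adjoin_ray K N b t : K 1 -> face_cone K N -> threshold N b t ->
  face_cone K (adjoin_ray N (t%:A - b)).
Proof.
move=> K1 [cN KN Nm1 fN] tb; have [_ NZ ND] := cN; have N1 := KN _ K1.
split.
- split=> // [l _ l0 [n [s [Nn s0 ->]]]|_ _ [n [s [Nn s0 ->]]] [p [r [Np r0 ->]]]].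
    exists (l *: n), (l * s); split; [exact: NZ|exact: mulr_ge0|].
    by rewrite scalerDr scalerA.
  exists (n + p), (s + r); split; [exact: ND|exact: addr_ge0|].
  by rewrite scalerDl addrACA.
- exact: subset_trans KN (@sub_adjoin_ray _ _).
- move=> [n [s [Nn s0 E]]].
  have [s_eq0|s_neq0] := eqVneq s 0.
    by apply: Nm1; rewrite E s_eq0 scale0r addr0.
  have {s0 s_neq0}s0 : 0 < s by rewrite lt_neqAle eq_sym s_neq0.
  have /tb.2 : 0 < s^-1 by rewrite invr_gt0.
  apply; have -> : b - t%:A - s^-1%:A = s^-1 *: n.
    have -> : n = - 1 - s *: (t%:A - b) by rewrite E addrK.
    rewrite scalerBr scalerA mulVf ?gt_eqF// scale1r scalerN.
    by rewrite -in_algE; ring.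
  by apply: NZ => //; rewrite invr_ge0 ltW.
- move=> psi1 psi2 Kpsi1 Kpsi2 Npsi.
  have Npsi12 x : N x -> 0 <= psi1 x + psi2 x.
    by move=> Nx; apply: Npsi; apply: sub_adjoin_ray.
  have Npsi1 := fN _ _ Kpsi1 Kpsi2 Npsi12.
  have Npsi2 x : N x -> 0 <= psi2 x.
    by apply: (fN psi2 psi1) => // z; rewrite addrC; apply: Npsi12.
  (* The two lower bounds [le1], [le2] add up to the upper bound [sum0]. *)
  have := Npsi _ (mem_adjoin_ray (t%:A - b) (cone0 cN N1)).
  rewrite !linearB !scalar_const => sum0.
  have le1 := threshold_le N1 tb Npsi1; have le2 := threshold_le N1 tb Npsi2.
  move=> _ [n [s [Nn s0 ->]]]; rewrite linearD linearZ /= linearB scalar_const.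
  apply: addr_ge0; first exact: Npsi1.
  by apply: mulr_ge0 => //; lra.
Qed.

Lemma face_cone_max K N0 : face_cone K N0 ->
  exists N, [/\ face_cone K N, N0 `<=` N
    & forall N', face_cone K N' -> N `<=` N' -> N' `<=` N].
Proof.
move=> fN0.
(* The union of the empty chain is empty, whence the union with [N0]. *)
have [F FP Ftot|N [fN Nmax]] := @Zorn_bigcup A (fun N => face_cone K (N0 `|` N)).
  have [F0|/existsNP[X0 /contrapT FX0]] := pselect (forall X, ~ F X).
    suff -> : \bigcup_(X in F) X = set0 by rewrite setU0.
    by apply/seteqP; split=> // x [X /F0].
  have sub X : F X -> N0 `|` X `<=` N0 `|` \bigcup_(X in F) X.
    by move=> FX x [N0x|Xx]; [left|right; exists X].
  have inv x : (N0 `|` \bigcup_(X in F) X) x -> exists2 X, F X & (N0 `|` X) x.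
    by move=> [N0x|[X FX Xx]]; [exists X0 => //; left|exists X => //; right].
  split.
  - split=> // [l c l0 /inv[X FX Xc]|c d /inv[X FX Xc] /inv[Y FY Yd]].
      by apply: (sub X) => //; have [[_ XZ _] _ _ _] := FP _ FX; apply: XZ.
    wlog XY : X Y c d FX FY Xc Yd / X `<=` Y.
      move=> H; case: (Ftot _ _ FX FY) => [|YX]; first exact: (H X Y).
      by rewrite addrC; apply: (H Y X).
    apply: (sub Y) => //; have [[_ _ YD] _ _ _] := FP _ FY; apply: YD => //.
    by case: Xc => [?|/XY]; [left|right].
  - by have [_ KN0 _ _] := fN0; move=> x /KN0; left.
  - by move=> /inv[X FX]; have [_ _] := FP _ FX.
  - move=> psi1 psi2 K1 K2 K12 x /inv[X FX Xx].
    have [_ _ _ /(_ _ _ K1 K2) fX] := FP _ FX.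
    by apply: fX => // z /(sub _ FX); apply: K12.
exists (N0 `|` N); split => // N' fN' NN' x N'x.
apply: contrapT => nx; apply: (Nmax N'); last first.
  by rewrite (_ : _ `|` _ = N')//; apply/seteqP; split=> [z [N0z|]|z] //;
    [apply: NN'; left|right].
by split=> [z Nz|]; [apply: NN'; right|move/(_ x N'x) => Nx; apply: nx; right].
Qed.

(** Every state of [N] vanishes on such [x]; conversely, the value at [b] of the
    pure state constructed below is the scalar [t] with [b - t]
    infinitesimal. *)
Definition infinitesimal N (x : A) : Prop :=
  forall e : R, 0 < e -> N (e%:A - x) /\ N (e%:A + x).

Lemma infinitesimal_scalar N psi x : N 1 ->
  (forall y, N y -> 0 <= psi y) -> infinitesimal N x -> psi x = 0.
Proof.
move=> N1 psiN nx; apply/eqP; rewrite eq_le -oppr_ge0.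
by apply/andP; split; apply: (@ge0_of_perturbed_ge0 _ (psi 1)) => [|e e0];
  rewrite ?psiN//; have [/psiN + /psiN] := nx _ e0;
  rewrite linearB linearD scalar_const addrC ?[_ + psi x]addrC.
Qed.

(** This makes the value [t] of [b] such that [b - t] is infinitesimal depend
    linearly on [b], so no extension theorem for linear forms is needed. *)
Lemma infinitesimal_lin N (l : R) x y : is_cone setT N -> N 1 ->
  infinitesimal N x -> infinitesimal N y -> infinitesimal N (l *: x + y).
Proof.
move=> cN N1 nx ny; have [_ NZ ND] := cN.
suff H (z w : A) : infinitesimal N z -> infinitesimal N w ->
    forall e, 0 < e -> N (e%:A + (l *: z + w)).
  have nN z : infinitesimal N z -> infinitesimal N (- z).
    by move=> nz e e0; rewrite opprK; have [] := nz _ e0.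
  move=> e e0; split; last exact: H.
  by rewrite opprD -scalerN; apply: H => //; apply: nN.
move=> nz nw e e0.
have d0 : 0 < 2 * (1 + `|l|) by have := normr_ge0 l; lra.
pose d := e / (2 * (1 + `|l|)); have dpos : 0 < d by apply: divr_gt0.
have dE : d * (2 * (1 + `|l|)) = e by rewrite /d divfK// gt_eqF.
have [Nm Np] := nz _ dpos; have [_ Nw] := nw _ dpos.
have dl : 0 <= d * (1 + `|l|) by rewrite mulr_ge0// ?ltW//; lra.
have -> : e%:A + (l *: z + w) =
  (`|l| * d)%:A + l *: z + (d%:A + w) + (d * (1 + `|l|))%:A.
  by rewrite -dE -[l *: z]mulr_algl -!in_algE; ring.
apply: (ND); last by apply: cone_alg.
apply: ND Nw.
have [l0|l0] := ger0P l.
  by rewrite -scalerA -scalerDr; apply: NZ.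
rewrite -scalerA -[l *: z]opprK -scaleNr -scalerBr.
by apply: NZ; rewrite // oppr_ge0 ltW.
Qed.

(** Extremality of [phi] among the states of [K], expressed by domination: a
    positive form below a multiple of [phi] is itself a multiple of [phi]. *)
Definition is_pure_state K (phi : {scalar A}) : Prop :=
  [/\ forall x, K x -> 0 <= phi x, phi 1 = 1
    & forall (psi : {scalar A}) (r : R),
        (forall x, K x -> 0 <= psi x <= r * phi x) ->
        forall x, psi x = psi 1 * phi x].

(** Start from the face of [K] where [a] is minimal and pass to a minimal face,
    that is, to a maximal cone [N].  Adjoining [t - b], with [t] the threshold of
    [b], does not enlarge [N], hence [b - t] is infinitesimal for every [b].  The
    map from [b] to [t] is then the only state of [N], and it is pure because [N]
    defines a face. *)
Lemma exists_pure_state K (a : A) :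
  unital_cone setT K -> archimedean setT K ->
  (forall e : R, 0 < e -> ~ K (a - e%:A)) ->
  exists2 phi, is_pure_state K phi & phi a <= 0.
Proof.
move=> uK arK aK; have [cK K1] := uK; have [_ KZ KD] := cK.
have Km1 : ~ K (-1).
  (* Otherwise the order unit [1] would force every element into [K]. *)
  move=> Km1; have [l [l0 _ Kla]] := arK a I; apply: (aK 1 ltr01).
  have -> : a - 1%:A = (l%:A + a) + (1 + l) *: (-1).
    by rewrite scalerN -!in_algE; ring.
  by apply: KD Kla _; apply: KZ => //; lra.
have [ta tapos] := threshold_exists a uK arK Km1.
have ta0 : ta <= 0.
  rewrite leNgt; apply/negP => t0; apply: (aK (ta / 2)); first by lra.
  have -> : a - (ta / 2)%:A = a - ta%:A + (ta / 2)%:A.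
    by rewrite {2}[ta]splitr -!in_algE; ring.
  by apply: tapos.1; lra.
have fK : face_cone K K by split.
have [N [fN N0N Nmax]] := face_cone_max (face_cone_adjoin_ray K1 fK tapos).
have [cN KN Nm1 faceN] := fN; have N1 := KN _ K1; have uN : unital_cone setT N by [].
have N_a : N (ta%:A - a) by apply: N0N; apply: mem_adjoin_ray; apply: cone0 cK K1.
have arN : archimedean setT N.
  by move=> x _; have [l [l0 ? ?]] := arK x I; exists l; split=> //; apply: KN.
have [_ NZ ND] := cN.
have val b : exists t, infinitesimal N (b - t%:A).
  have [t tb] := threshold_exists b uN arN Nm1; exists t => e e0; split.
    rewrite opprB; apply: ND; first by apply: cone_alg => //; apply: ltW.
    apply: (Nmax _ (face_cone_adjoin_ray K1 fN tb) (@sub_adjoin_ray _ _)).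
    by apply: mem_adjoin_ray; apply: cone0 cN N1.
  by rewrite addrC; apply: tb.1.
have valU s : infinitesimal N s%:A -> s = 0.
  move=> ns; apply/eqP; rewrite eq_le -oppr_ge0.
  by apply/andP; split; apply: (@ge0_of_perturbed_ge0 _ 1) => // e e0;
    apply: (cone_nonneg_const uN Nm1); have [+ +] := ns _ e0;
    rewrite mulr1 -scalerBl -scalerDl addrC // => ? ?; rewrite addrC.
have [f fP] := choice val.
have f_eq b t : infinitesimal N (b - t%:A) -> f b = t.
  move=> nb; apply/eqP; rewrite -subr_eq0; apply/eqP/valU.
  have -> : (f b - t)%:A = (-1) *: (b - (f b)%:A) + (b - t%:A).
    by rewrite scaleN1r -!in_algE; ring.
  exact: infinitesimal_lin.
have flin : linear_for *%R f.
  move=> l x y; apply: f_eq.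
  have -> : l *: x + y - (l * f x + f y)%:A =
    l *: (x - (f x)%:A) + (y - (f y)%:A).
    by rewrite -[l *: x]mulr_algl -[l *: (x - _)]mulr_algl -!in_algE; ring.
  exact: infinitesimal_lin.
pose phi : {scalar A} := HB.pack f (GRing.isLinear.Build R A R *%R f flin).
have phi1 : phi 1 = 1.
  apply: f_eq => e e0; rewrite scale1r subrr subr0 addr0.
  by split; apply: cone_alg => //; apply: ltW.
have phiN x : N x -> 0 <= phi x.
  move=> Nx; change (0 <= f x).
  apply: (@ge0_of_perturbed_ge0 _ 1) => // e e0; rewrite mulr1.
  apply: (cone_nonneg_const uN Nm1).
  have [+ _] := fP x _ e0.
  have -> : (f x + e)%:A = e%:A - (x - (f x)%:A) + x.
    by rewrite -!in_algE; ring.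
  by move=> Ne; apply: ND.
exists phi; last by have := phiN _ N_a; rewrite linearB scalar_const phi1; lra.
split=> // [x /KN|psi r psiK x]; first exact: phiN.
have Npsi : forall z, N z -> 0 <= psi z.
  pose g x := r * phi x - psi x.
  have glin : linear_for *%R g.
    by move=> l y z; rewrite /g !linearP /=; ring.
  pose chi : {scalar A} := HB.pack g (GRing.isLinear.Build R A R *%R g glin).
  apply: (faceN psi chi) => [y /psiK/andP[]|y /psiK/andP[_]|y Ny] //=.
    by rewrite /g subr_ge0.
  rewrite /g addrC subrK; apply: mulr_ge0; last exact: phiN.
  by have /andP[p0 /(le_trans p0)] := psiK _ K1; rewrite phi1 mulr1.
have := infinitesimal_scalar N1 Npsi (fP x).
by rewrite linearB scalar_const => /eqP; rewrite subr_eq0 => /eqP ->; rewrite mulrC.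
Qed.

End PureStates.

(** * Uniform bounds in the product cone *)

Section Bounds.
Variables (R : realType) (A : comAlgType R).
Implicit Types (N B C : set A).

(** For [T] a point this is the bound in the Archimedean property; for [T] the
    natural numbers it controls the sequence of multiples [b^(2k) x]. *)
Definition uniformly_bounded N (T : Type) (F : T -> A) : Prop :=
  exists l : R, forall k, N (l%:A - F k) /\ N (l%:A + F k).

Lemma uniformly_bounded_lin B N T (F G : T -> A) (s : R) :
  unital_cone B N -> uniformly_bounded N F -> uniformly_bounded N G ->
  uniformly_bounded N (fun k => s *: F k + G k).
Proof.
move=> [[_ NZ ND] N1] [l Fl] [p Gp]; exists (`|s| * l + p) => k.
have [Fm Fp] := Fl k; have [Gm Gpl] := Gp k.
have [s0|s0] := ger0P s; split.
- have -> : (s * l + p)%:A - (s *: F k + G k) = s *: (l%:A - F k) + (p%:A - G k).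
    by rewrite -[s *: F k]mulr_algl -[s *: (_ - _)]mulr_algl -!in_algE; ring.
  by apply: ND => //; apply: NZ.
- have -> : (s * l + p)%:A + (s *: F k + G k) = s *: (l%:A + F k) + (p%:A + G k).
    by rewrite -[s *: F k]mulr_algl -[s *: (_ + _)]mulr_algl -!in_algE; ring.
  by apply: ND => //; apply: NZ.
- have -> : (- s * l + p)%:A - (s *: F k + G k) =
    (- s) *: (l%:A + F k) + (p%:A - G k).
    by rewrite -[s *: F k]mulr_algl -[- s *: (_ + _)]mulr_algl -!in_algE; ring.
  by apply: ND => //; apply: NZ => //; rewrite oppr_ge0 ltW.
- have -> : (- s * l + p)%:A + (s *: F k + G k) =
    (- s) *: (l%:A - F k) + (p%:A + G k).
    by rewrite -[s *: F k]mulr_algl -[- s *: (_ - _)]mulr_algl -!in_algE; ring.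
  by apply: ND => //; apply: NZ => //; rewrite oppr_ge0 ltW.
Qed.

(** Since [1 - b^2] is in [C], the elements [b^(2k) d^2] decrease in [k]:
    [b^(2k) d^2 - b^(2k+2) d^2 = (b^k d)^2 (1 - b^2)].  So a bound for [d^2]
    serves all [k], and squares span [B]. *)
Lemma quadratic_powers_bounded B C b e : subalgebra B ->
  quadratic_module B C -> archimedean B C -> B b -> C (1 - b ^+ 2) -> B e ->
  uniformly_bounded C (fun k => b ^+ (2 * k) * e).
Proof.
move=> subB; have /subalgP[B1 BL BM] := subB; move=> [uC Csq] arC Bb Cb Be.
have [[CB CZ CD] C1] := uC.
have BX d k : B d -> B (d ^+ k).
  by move=> Bd; elim: k => [|k IHk]; rewrite ?expr0 // exprS; apply: BM.
have square d : B d -> uniformly_bounded C (fun k => b ^+ (2 * k) * d ^+ 2).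
  move=> Bd; have [l [l0 Cl _]] := arC _ (BX d 2 Bd); exists l => k; split.
    suff H : C (d ^+ 2 - b ^+ (2 * k) * d ^+ 2).
      have -> : l%:A - b ^+ (2 * k) * d ^+ 2 =
        (l%:A - d ^+ 2) + (d ^+ 2 - b ^+ (2 * k) * d ^+ 2) by ring.
      exact: CD.
    elim: k => [|k IHk].
      rewrite muln0 expr0 mul1r subrr -(scale0r 1); exact: CZ.
    have -> : d ^+ 2 - b ^+ (2 * k.+1) * d ^+ 2 =
      (d ^+ 2 - b ^+ (2 * k) * d ^+ 2) + (b ^+ k * d) ^+ 2 * (1 - b ^+ 2).
      by rewrite exprMn -exprM mulnC mulSn exprD mulnC; ring.
    by apply: CD => //; apply: Csq => //; apply: BM => //; apply: BX.
  apply: CD; first by apply: CZ => //; apply: ltW.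
  have -> : b ^+ (2 * k) * d ^+ 2 = (b ^+ k * d) ^+ 2 * 1.
    by rewrite exprMn -exprM mulnC mulr1.
  by apply: Csq => //; apply: BM => //; apply: BX.
move: e Be; apply: square_span_ind => // l x y Hx Hy.
have [p Hp] := uniformly_bounded_lin l uC Hx Hy.
by exists p => k; rewrite mulrDr -scalerAr.
Qed.

End Bounds.

(** If [u 1 > 2 u 0], the increments [u k.+1 - 2 u k] at least double at each
    step, by the second hypothesis, and [u] is unbounded.  The constant [2] has
    no meaning: any constant above [1] would work with the square
    [(z - s)^2] in place of [(z - 2)^2 = z^2 - 4 z + 4]. *)
Lemma bounded_growth (R : realType) (u : nat -> R) (c : R) :
  (forall k, 0 <= u k <= c) ->
  (forall k, 0 <= u k.+2 - 4 * u k.+1 + 4 * u k) -> u 1%N <= 2 * u 0%N.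
Proof.
move=> u_c u_conv; rewrite leNgt; apply/negP => d0.
pose d := u 1%N - 2 * u 0%N; have dpos : 0 < d by rewrite subr_gt0.
have grow k : 2 ^+ k * d <= u k.+1 - 2 * u k.
  elim: k => [|k IHk]; first by rewrite mul1r.
  by rewrite exprS -mulrA; have := u_conv k; lra.
have c0 : 0 <= c / d.
  by apply: divr_ge0; [have /andP[/le_trans + +] := u_c 0%N; apply|apply: ltW].
have := archi_boundP c0; set n := Num.bound _ => cn.
have : c < 2 ^+ n * d.
  rewrite -ltr_pdivrMr //; apply: lt_trans cn _.
  by rewrite -natrX ltr_nat ltn_expl.
have /andP[_ un1] := u_c n.+1; have /andP[un _] := u_c n.
by have := grow n; lra.
Qed.

Section ProductBounds.
Variables (R : realType) (A : comAlgType R) (m : nat).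
Variables (B C : 'I_m -> set A) (M : set A).
Hypothesis subB : forall i, subalgebra (B i).
Hypothesis genB : generated_by B.
Hypothesis hM : unital_cone setT M.
Hypothesis C1 : forall i, C i 1.
Let K := cone (cons_family M C).

Lemma product_uniformly_bounded (T : Type) (g : T -> 'I_m -> A) :
  (forall j e, B j e -> uniformly_bounded (C j) (fun k => g k j * e)) ->
  forall x, uniformly_bounded K (fun k => (\prod_j g k j) * x).
Proof.
move=> gB; have uK := unital_product_cone hM C1.
apply: (product_span_ind subB genB) => [s x y Hx Hy|d Bd].
  have [l Hl] := uniformly_bounded_lin s uK Hx Hy.
  by exists l => k; rewrite mulrDr -scalerAr.
have /choice[l Hl] : forall j, exists l : R, forall k,
    C j (l%:A - g k j * d j) /\ C j (l%:A + g k j * d j).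
  by move=> j; apply: gB.
exists (\prod_j l j) => k; rewrite -big_split -in_algE rmorph_prod.
by apply: prod_dominated => // j; apply: Hl.
Qed.

Lemma archimedean_product : (forall i, archimedean (B i) (C i)) ->
  archimedean setT K.
Proof.
move=> arC x _; have [[_ KZ KD] K1] := unital_product_cone hM C1.
have [|l /(_ tt)[]] := @product_uniformly_bounded unit (fun _ _ => 1) _ x.
  move=> j e Be; have [l [_ Cm Cp]] := arC j e Be.
  by exists l => k; rewrite mul1r.
rewrite big1 // mul1r => Km Kp; exists (`|l| + 1).
have l1 : 0 <= `|l| + 1 - l by have := ler_norm l; lra.
split; first by have := normr_ge0 l; lra.
  have -> : (`|l| + 1)%:A - x = (`|l| + 1 - l)%:A + (l%:A - x).
    by rewrite -!in_algE; ring.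
  by apply: KD => //; apply: KZ.
have -> : (`|l| + 1)%:A + x = (`|l| + 1 - l)%:A + (l%:A + x).
  by rewrite -!in_algE; ring.
by apply: KD => //; apply: KZ.
Qed.

(** The powers of [b] are absorbed into the [i]-th slot. *)
Lemma powers_bounded i b : (forall i, archimedean (B i) (C i)) ->
  quadratic_module (B i) (C i) -> B i b -> C i (1 - b ^+ 2) ->
  forall x, uniformly_bounded K (fun k => b ^+ (2 * k) * x).
Proof.
move=> arC qC Bb Cb x.
have [|l Hl] := @product_uniformly_bounded nat
  (fun k j => if j == i then b ^+ (2 * k) * 1 else 1) _ x.
  move=> j e Be; case: eqP => [ji|_].
    have := quadratic_powers_bounded (subB i) qC (arC i) Bb Cb.
    by rewrite -ji => /(_ _ Be)[l Hl]; exists l => k; rewrite mulr1.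
  have [l [_ Cm Cp]] := arC j e Be.
  by exists l => k; rewrite mul1r.
exists l => k; have := Hl k.
by rewrite (prod_update (fun=> 1)) big1 // mulr1.
Qed.

(** * Multiplicativity of pure states *)

(** The sequence [u k = phi (b^(2k) x)] is bounded, and [phi] is nonnegative at
    [(b^k (b^2 - 2))^2 x], which is the convexity condition of
    [bounded_growth]. *)
Lemma square_contraction (phi : {scalar A}) i b :
  (forall i, archimedean (B i) (C i)) ->
  (forall x, K x -> 0 <= phi x) ->
  quadratic_module (B i) (C i) -> B i b -> C i (1 - b ^+ 2) ->
  forall x, K x -> 0 <= phi (b ^+ 2 * x) <= 2 * phi x.
Proof.
move=> arC Kphi qC Bb Cb x Kx; have [_ Csq] := qC.
have /subalgP[B1 BL BM] := subB i.
have phi_sq d : B i d -> 0 <= phi (d ^+ 2 * x).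
  by move=> Bd; apply: Kphi; apply: cone_mull Kx => c; apply: Csq.
have BX k : B i (b ^+ k).
  by elim: k => [|k IHk]; rewrite ?expr0 // exprS; apply: BM.
rewrite phi_sq //=.
have [l Hl] := powers_bounded arC qC Bb Cb x.
pose u k := phi (b ^+ (2 * k) * x).
have u0 k : 0 <= u k by rewrite /u mulnC exprM; apply: phi_sq.
have := @bounded_growth _ u (l * phi 1); rewrite /u muln0 muln1 expr0 mul1r.
apply=> k; first rewrite u0 /=.
  have [/Kphi + _] := Hl k.
  by rewrite linearB linearZ subr_ge0.
have Bp : B i (b ^+ k * (b ^+ 2 - 2)).
  apply: BM => //.
  have -> : b ^+ 2 - 2 = (- 2) *: 1 + b ^+ 2 by rewrite scaleNr scaler_nat addrC.
  exact: BL.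
have := phi_sq _ Bp.
have -> : (b ^+ k * (b ^+ 2 - 2)) ^+ 2 * x =
  b ^+ (2 * k.+2) * x - 4 *: (b ^+ (2 * k.+1) * x) + 4 *: (b ^+ (2 * k) * x).
  rewrite !scaler_nat exprMn -exprM !mul2n -!muln2 !mulSn !exprD; ring.
by rewrite linearD linearB !linearZ.
Qed.

Definition multiplicative_at (phi : {scalar A}) (p : A) : Prop :=
  forall y, phi (p * y) = phi p * phi y.

Lemma multiplicative_at_lin (phi : {scalar A}) (l : R) p q :
  multiplicative_at phi p -> multiplicative_at phi q ->
  multiplicative_at phi (l *: p + q).
Proof.
by move=> mp mq y; rewrite mulrDl -scalerAl !linearP /= mp mq mulrDl mulrA.
Qed.

(** The form [x |-> phi (p x)] is dominated by [r phi], and its value at [1] is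
    [phi p]. *)
Lemma pure_multiplicative (phi : {scalar A}) (r : R) p :
  is_pure_state K phi ->
  (forall x, K x -> 0 <= phi (p * x) <= r * phi x) -> multiplicative_at phi p.
Proof.
move=> [_ _ pure] pr x; pose f y := phi (p * y).
have flin : linear_for *%R f.
  by move=> l y z; rewrite /f mulrDr -scalerAr linearP.
pose psi : {scalar A} := HB.pack f (GRing.isLinear.Build R A R *%R f flin).
by have := pure psi r pr x; rewrite /= /f mulr1.
Qed.

(** The elements at which [phi] is multiplicative form a subalgebra, so the
    spanning multipliers of each [B i] suffice: the elements of [C i] for a
    semiring, the squares of [B i] for a quadratic module. *)
Lemma pure_state_mul (phi : {scalar A}) :
  (forall i, (is_semiring (B i) (C i) \/ quadratic_module (B i) (C i)) /\
     archimedean (B i) (C i)) ->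
  is_pure_state K phi -> forall x, multiplicative_at phi x.
Proof.
move=> hC pure; have [Kphi phi1 _] := pure.
have arC i := (hC i).2.
have mul0 : multiplicative_at phi 0 by move=> y; rewrite mul0r linear0 mul0r.
apply: (generated_sub genB) => [|i b Bb].
  apply/subalgP; split=> [y|l p q mp mq|p q mp mq y].
  - by rewrite phi1 !mul1r.
  - exact: multiplicative_at_lin.
  - by rewrite -mulrA mp mq mp mulrA.
have /subalgP[B1 BL BM] := subB i.
have [[[[CB _ _] _] CM]|qC] := (hC i).1.
  have mulC c : C i c -> multiplicative_at phi c.
    move=> Cc; have [l [_ Cl _]] := arC i c (CB _ Cc).
    apply: (pure_multiplicative (r := l) pure) => x Kx.
    rewrite Kphi /=; last by apply: cone_mull Kx => d; apply: CM.
    have : K ((l%:A - c) * x) by apply: cone_mull Kx => d; apply: CM.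
    by move/Kphi; rewrite mulrBl mulr_algl linearB linearZ subr_ge0.
  have [l [_ _ Cp]] := arC i b Bb.
  have -> : b = (- l) *: 1 + (l%:A + b) by rewrite scaleNr addKr.
  by apply: multiplicative_at_lin; apply: mulC.
move: b Bb; apply: square_span_ind => // [l p q|d Bd].
  exact: multiplicative_at_lin.
have [l [l0 Cl _]] := arC i _ (BM _ _ Bd Bd).
(* Rescale [d] so that [1 - (d / s)^2] is in [C i]; [s^2 >= l] suffices, and
   [l + 1] avoids a square root. *)
pose s := l + 1; have s0 : s != 0 by rewrite gt_eqF // /s; lra.
have -> : d ^+ 2 = (s ^+ 2) *: (s^-1 *: d) ^+ 2 + 0.
  by rewrite addr0 exprZn scalerA -exprMn divff // expr1n scale1r.
apply: multiplicative_at_lin => //.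
apply: (pure_multiplicative (r := 2) pure).
have Bsd : B i (s^-1 *: d) by apply: (subalgebra_scale_shift (subB i)).1.
apply: (square_contraction arC Kphi qC Bsd).
have [[[_ CZ CD] Ci1] _] := qC.
have -> : 1 - (s^-1 *: d) ^+ 2 =
  (s^-1 ^+ 2) *: ((l%:A - d * d) + (s ^+ 2 - l)%:A).
  have -> : (l%:A - d * d) + (s ^+ 2 - l)%:A = (s ^+ 2)%:A - d ^+ 2.
    by rewrite -!in_algE; ring.
  by rewrite scalerBr scalerA -exprMn mulVf // expr1n scale1r exprZn.
apply: (CZ); first exact: sqr_ge0.
apply: CD => //; apply: CZ => //.
have -> : s ^+ 2 - l = l ^+ 2 + l + 1 by rewrite /s; ring.
by have := sqr_ge0 l; lra.
Qed.

End ProductBounds.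

Theorem theorem2 (R : realType) (A : comAlgType R) (m : nat)
    (B : 'I_m -> set A) (C : 'I_m -> set A) (M : set A)
    (subB : forall i, subalgebra (B i))
    (genB : generated_by B)
    (hC : forall i, (is_semiring (B i) (C i) \/ quadratic_module (B i) (C i))
                    /\ archimedean (B i) (C i))
    (hM : unital_cone setT M)
    (a : A) :
  (forall chi : character A,
     (char M `&` \bigcap_i char (C i)) chi -> 0 < chi a)
  <->
  (exists eps : R,
     0 < eps /\ [set eps%:A + c | c in cone (cons_family M C)] a).
Proof.
have C1 i : C i 1 by have [[[[_ ?] _]|[[_ ?] _]] _] := hC i.
have arC i := (hC i).2.
split=> [pos_a|[eps [eps0 [c Kc <-]]] chi [chiM chiC]]; last first.
  rewrite linearD linearZ /= rmorph1 mulr1; apply: ltr_wpDr => //.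
  move: c Kc; apply: cone_ind => [|x y x0 y0|c0 f Mc0 Cf].
  - by rewrite linear0.
  - by rewrite /= linearD; apply: addr_ge0.
  - rewrite /= rmorphM rmorph_prod; apply: mulr_ge0; first exact: chiM.
    by apply: prodr_ge0 => j _; apply: chiC.
apply: contrapT => nK; set K := cone _ in nK.
have aK eps : 0 < eps -> ~ K (a - eps%:A).
  move=> eps0 Ka; apply: nK; exists eps; split=> //.
  by exists (a - eps%:A); rewrite // addrC subrK.
have uK := unital_product_cone hM C1.
have [phi pure phia] :=
  exists_pure_state uK (archimedean_product subB genB hM C1 arC) aK.
have [Kphi phi1 _] := pure.
have phiM := pure_state_mul subB genB hM C1 hC pure.
pose chi : character A := HB.pack (phi : A -> R) (GRing.Linear.on phi)
  (GRing.isMonoidMorphism.Build A R phi (conj phi1 phiM)).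
have : 0 < chi a.
  apply: pos_a; split=> [c Mc|i _ c Cc]; apply: Kphi.
    exact: sub_product_coneM C1 _ Mc.
  exact: sub_product_cone hM C1 _ _ Cc.
by rewrite ltNge phia.
Qed.
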